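(* Let $M$ be a positive integer and let $\rho,\sigma$ be finite-dimensional representations of $\mathrm{SL}_2(\mathbb{Z})$ with finite index kernels. Let $\pi_{M,\rho,\sigma}:(T_M\rho)\otimes(T_M\sigma)\to T_M(\rho\otimes\sigma)$ be the linear map with $(v\otimes\mathfrak{e}_m)\otimes(w\otimes\mathfrak{e}_{m'})\mapsto (v\otimes w)\otimes\mathfrak{e}_m$ if $m=m'$ and $\mapsto 0$ otherwise. Then for every $k\in\mathbb{Z}$, $F\mapsto \pi_{M,\rho,\sigma}\circ F$ is a linear map $\mathrm{M}_k(T_M\rho\otimes T_M\sigma)\to\mathrm{M}_k(T_M(\rho\otimes\sigma))$, and for all $f\in\mathrm{M}_k(\rho)$, $g\in\mathrm{M}_l(\sigma)$ we have \[ \pi_{M,\rho,\sigma}\circ\big((T_Mf)\otimes(T_Mg)\big)=T_M(f\otimes g), \] where $f\otimes g\in\mathrm{M}_{k+l}(\rho\otimes\sigma)$ and $T_M(f\otimes g)$ is formed in weight $k+l$.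
   Context: For a finite-dimensional representation $\rho$ of $\mathrm{SL}_2(\mathbb{Z})$ on $V(\rho)$, $(f|_{k,\rho}\gamma)(\tau)=(c\tau+d)^{-k}\rho(\gamma^{-1})f(\gamma\tau)$ for $\gamma=\begin{pmatrix}a&b\\c&d\end{pmatrix}$; $\mathrm{M}_k(\rho)$ is the space of holomorphic $f:\mathbb{H}\to V(\rho)$ invariant under all $|_{k,\rho}\gamma$ with $\lambda\circ f$ bounded as $\tau\to i\infty$ for every linear functional $\lambda$. For $m=\begin{pmatrix}a&b\\0&d\end{pmatrix}$, $a,d>0$: $(f|_km)(\tau)=(a/d)^{k/2}f((a\tau+b)/d)$. $\Delta_M=\{\begin{pmatrix}a&b\\0&d\end{pmatrix}\in M_2(\mathbb{Z}):a,d>0,ad=M,0\le b<d\}$; every integer matrix $x$ of determinant $M$ is uniquely $x=\gamma'\overline{x}$ with $\gamma'\in\mathrm{SL}_2(\mathbb{Z})$, $\overline{x}\in\Delta_M$; define $I_m(\gamma)$ by $m\gamma=I_m(\gamma)\overline{m\gamma}$. $T_M\rho$ acts on $V(\rho)\otimes\mathbb{C}[\Delta_M]$ by $(T_M\rho)(\gamma)(v\otimes\mathfrak{e}_m)=\rho(I_m(\gamma^{-1}))^{-1}v\otimes\mathfrak{e}_{\overline{m\gamma^{-1}}}$, and $T_Mf=\sum_{m\in\Delta_M}(f|_km)\otimes\mathfrak{e}_m$. $(f\otimes g)(\tau)=f(\tau)\otimes g(\tau)$. *)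

(* Defs.v *)
From HB Require Import structures.
From mathcomp Require Import all_boot all_order all_algebra complex.
From mathcomp Require Import all_classical all_reals all_analysis.
From mathcomp Require Import ring zify.
Set Implicit Arguments.
Unset Strict Implicit.
Unset Printing Implicit Defensive.
Import Order.TTheory GRing.Theory Num.Theory.
Import numFieldNormedType.Exports.
Local Open Scope ring_scope.
Local Open Scope complex_scope.

Definition mx2 (a b c d : int) : 'M[int]_2 :=
  \matrix_(i, j) if i == 0 then if j == 0 then a else b
                 else if j == 0 then c else d.

Lemma mx2E a b c d :
  ((mx2 a b c d 0 0 = a) * (mx2 a b c d 0 1 = b)) *
  ((mx2 a b c d 1 0 = c) * (mx2 a b c d 1 1 = d)).
Proof. by rewrite !mxE. Qed.

Lemma mx2P (A : 'M[int]_2) : A = mx2 (A 0 0) (A 0 1) (A 1 0) (A 1 1).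
Proof.
apply/matrixP => i j; rewrite mxE.
have ord2 (k : 'I_2) : k = if k == 0 then 0 else 1.
  by apply/val_inj; case: k => [[|[|]]].
by rewrite {1}(ord2 i) {1}(ord2 j); case: eqP; case: eqP.
Qed.

Lemma mulmx2 (A B : 'M[int]_2) : A *m B =
  mx2 (A 0 0 * B 0 0 + A 0 1 * B 1 0) (A 0 0 * B 0 1 + A 0 1 * B 1 1)
      (A 1 0 * B 0 0 + A 1 1 * B 1 0) (A 1 0 * B 0 1 + A 1 1 * B 1 1).
Proof.
have e1 : lift ord0 ord0 = 1 :> 'I_2 by apply: val_inj.
by rewrite [LHS]mx2P !mxE !big_ord_recl !big_ord0 !addr0 !e1.
Qed.

Lemma det_mx2E a b c d : \det (mx2 a b c d) = a * d - b * c.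
Proof.
rewrite (expand_det_row _ 0) !big_ord_recl big_ord0 addr0 /cofactor !det_mx11.
have e1 : lift ord0 ord0 = 1 :> 'I_2 by apply: val_inj.
have e0 : lift 1 0 = 0 :> 'I_2 by apply: val_inj.
by rewrite !mxE !e1 !e0 /= expr0 expr1 mul1r mulN1r mulrN.
Qed.

Record SL2Z := SL2ZElt { SL2Z_mx :> 'M[int]_2; _ : \det SL2Z_mx == 1 }.

HB.instance Definition _ := [isSub for SL2Z_mx].
HB.instance Definition _ := [Choice of SL2Z by <:].

Lemma det_SL2Z (g : SL2Z) : \det g = 1.
Proof. by case: g => g /= /eqP. Qed.

Fact SL2Z_one_det : \det (1%:M : 'M[int]_2) == 1.
Proof. by rewrite det1. Qed.

Fact SL2Z_mul_det (g h : SL2Z) : \det (g *m h) == 1.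
Proof. by rewrite det_mulmx !det_SL2Z. Qed.

Fact SL2Z_inv_det (g : SL2Z) : \det (\adj g) == 1.
Proof.
by rewrite -[\det _]mul1r -{1}(det_SL2Z g) -det_mulmx mul_mx_adj det_SL2Z det1.
Qed.

Definition SL2Z_one : SL2Z := SL2ZElt SL2Z_one_det.
Definition SL2Z_mul (g h : SL2Z) : SL2Z := SL2ZElt (SL2Z_mul_det g h).
Definition SL2Z_inv (g : SL2Z) : SL2Z := SL2ZElt (SL2Z_inv_det g).

Fact SL2Z_mulA : associative SL2Z_mul.
Proof. by move=> g h u; apply/val_inj; rewrite /= mulmxA. Qed.
Fact SL2Z_mul1 : left_id SL2Z_one SL2Z_mul.
Proof. by move=> g; apply/val_inj; rewrite /= mul1mx. Qed.
Fact SL2Z_mulr1 : right_id SL2Z_one SL2Z_mul.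
Proof. by move=> g; apply/val_inj; rewrite /= mulmx1. Qed.
Fact SL2Z_mulV : left_inverse SL2Z_one SL2Z_inv SL2Z_mul.
Proof. by move=> g; apply/val_inj; rewrite /= mul_adj_mx det_SL2Z. Qed.
Fact SL2Z_mulrV : right_inverse SL2Z_one SL2Z_inv SL2Z_mul.
Proof. by move=> g; apply/val_inj; rewrite /= mul_mx_adj det_SL2Z. Qed.

HB.instance Definition _ := isGroup.Build SL2Z
  SL2Z_mulA SL2Z_mul1 SL2Z_mulr1 SL2Z_mulV SL2Z_mulrV.

Lemma SL2Z_mxM (g h : SL2Z) : (g * h)%g = g *m h :> 'M[int]_2.
Proof. by []. Qed.
Lemma SL2Z_mx1 : (1 : SL2Z)%g = 1%:M :> 'M[int]_2.
Proof. by []. Qed.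

(* [Delta M] is the finite set of upper triangular representatives. It is empty
   for [M = 0], since the diagonal entries are positive. *)
Definition in_Delta (M : nat) (m : 'M[int]_2) : bool :=
  [&& m 1 0 == 0, 0 < m 0 0, 0 < m 1 1, m 0 0 * m 1 1 == M%:Z
    & 0 <= m 0 1 < m 1 1].

Record Delta (M : nat) := DeltaElt
  { Delta_mx :> 'M[int]_2; _ : in_Delta M Delta_mx }.

HB.instance Definition _ M := [isSub for @Delta_mx M].
HB.instance Definition _ M := [Choice of Delta M by <:].

Section DeltaFin.
Variable M : nat.
Let code (m : Delta M) : 'I_M.+1 * 'I_M.+1 * 'I_M.+1 :=
  (inord `|m 0 0|, inord `|m 0 1|, inord `|m 1 1|).
Let decode (t : 'I_M.+1 * 'I_M.+1 * 'I_M.+1) : option (Delta M) :=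
  insub (mx2 (t.1.1)%:Z (t.1.2)%:Z 0 (t.2)%:Z).

Fact Delta_pcan : pcancel code decode.
Proof.
case=> m mP; rewrite /code /decode /=; have := mP.
case/and5P => /eqP c0 a0 d0 /eqP ad /andP[b0 bd].
have [aM dM] : m 0 0 <= M%:Z /\ m 1 1 <= M%:Z 
  by rewrite -ad; split; [apply: ler_peMr | apply: ler_peMl]; lia.
rewrite !inordK; try lia.
rewrite !gez0_abs ?(ltW a0) ?(ltW d0) // -[X in mx2 _ _ X]c0 -mx2P.
exact: (valK (DeltaElt mP)).
Qed.

HB.instance Definition _ := PCanIsCountable Delta_pcan.
HB.instance Definition _ := fintype.isFinite.Build (Delta M) (pcan_enumP Delta_pcan).
End DeltaFin.

Lemma det_Delta M (m : Delta M) : \det m = M%:Z.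
Proof.
case: m => m /= /and5P[/eqP c0 _ _ /eqP ad _].
by rewrite [m]mx2P det_mx2E c0 mulr0 subr0.
Qed.

Lemma Delta_gt0 M (m : Delta M) : (0 < M)%N.
Proof. by case: m => m /= /and5P[_ a0 d0 /eqP ad _]; nia. Qed.

Lemma Delta_decomposition (M : nat) (x : 'M[int]_2) :
  (0 < M)%N -> \det x = M%:Z ->
  exists! p : SL2Z * Delta M, x = p.1 *m p.2.
Proof.
move=> M0 dx.
have key : exists p : SL2Z * Delta M, x = p.1 *m p.2.
  have := dx; rewrite {1}[x]mx2P det_mx2E.
  set p := x 0 0; set q := x 1 0; set r := x 0 1; set s := x 1 1 => dx'.
  have [u [v uv]] := Bezoutz p q.
  have g0 : 0 < gcdz p q.
    rewrite lt_neqAle eq_sym gcdz_eq0 lez_nat andbT.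
    by apply/negP => /andP[/eqP p0 /eqP q0]; rewrite p0 q0 in dx'; lia.
  have [/dvdzP[p' pE] /dvdzP[q' qE]] := (dvdz_gcdl p q, dvdz_gcdr p q).
  move: uv pE qE g0; move: (gcdz p q) => g uv pE qE g0.
  have det1' : u * p' + v * q' = 1.
    by apply: (mulIf (lt0r_neq0 g0)); rewrite mul1r -[RHS]uv pE qE; ring.
  pose d := p' * s - q' * r; pose b := u * r + v * s.
  have dg : g * d = M by rewrite -dx' pE qE /d; ring.
  have d0 : 0 < d by rewrite -(pmulr_rgt0 _ g0) dg; lia.
  pose n := (b %/ d)%Z; pose b' := (b %% d)%Z.
  have bE : b = n * d + b' := divz_eq b d.
  pose y := mx2 p' (n * p' - v) q' (n * q' + u).
  have dy : \det y == 1 by rewrite det_mx2E -det1'; apply/eqP; ring.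
  have zP : in_Delta M (mx2 g b' 0 d).
    by rewrite /in_Delta !mx2E eqxx g0 d0 dg eqxx modz_ge0 ?ltz_pmod // lt0r_neq0.
  exists (SL2ZElt dy, DeltaElt zP); rewrite /= mulmx2 !mx2E [LHS]mx2P.
  have b'E : b' = b - n * d by rewrite bE; ring.
  rewrite !mulr0 !addr0 b'E /b; congr mx2 => //.
  - by rewrite -/r -[LHS]mul1r -det1' /d; ring.
  - by rewrite -/s -[LHS]mul1r -det1' /d; ring.
case: key => p xE; exists p; split=> // p' xE'.
case: p xE => g m /= xE; case: p' xE' => g' m' /= xE'.
have gE : (g'^-1 * g)%g *m m = m'.
  rewrite SL2Z_mxM -mulmxA -xE xE' mulmxA -SL2Z_mxM.
  by rewrite mulVg mul1mx.
suff h1 : (g'^-1 * g)%g = 1%g.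
  move: gE; rewrite h1 mul1mx => /val_inj ->.
  by congr (_, _); apply: (mulgI g'^-1%g); rewrite h1 mulVg.
move: (g'^-1 * g)%g gE => h {xE xE' g g'} hE.
have := hE; rewrite mulmx2 [RHS]mx2P => /matrixP E.
move: (E 0 0) (E 0 1) (E 1 0) (E 1 1); rewrite !mx2E => {E hE}.
have := det_SL2Z h; rewrite {1}[h : 'M[int]_2]mx2P det_mx2E.
case: m m' => m /= /and5P[/eqP -> a0 d0 /eqP ad /andP[b0 bd]].
case=> m' /= /and5P[/eqP -> a0' d0' /eqP ad' /andP[b0' bd']].
rewrite !mulr0 !addr0 => dh e00 e01 e10 e11.
have h10 : h 1 0 = 0.
  by apply/eqP; move/eqP: e10; rewrite mulf_eq0 (negPf (lt0r_neq0 a0)) orbF.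
rewrite h10 mulr0 subr0 in dh; rewrite h10 mul0r add0r in e11.
have [h00 h11] : h 0 0 = 1 /\ h 1 1 = 1.
  have h00 : 0 < h 0 0 by rewrite -(pmulr_lgt0 _ a0) e00.
  have h11 : 0 < h 1 1 by rewrite -(pmulr_rgt0 _ h00) dh.
  by split; nia.
have h01 : h 0 1 = 0.
  rewrite h00 mul1r in e01; rewrite h11 mul1r in e11; rewrite -e11 in bd'.
  by nia.
apply/val_inj; rewrite /= [LHS]mx2P h00 h11 h01 h10 [RHS]mx2P.
by rewrite !mxE.
Qed.

Fact Delta_mul_ex M (m : Delta M) (g : SL2Z) :
  exists p : SL2Z * Delta M, m *m g == p.1 *m p.2 :> 'M[int]_2.
Proof.
have [|p [pE _]] := @Delta_decomposition M (m *m g) (Delta_gt0 m).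
  by rewrite det_mulmx det_Delta det_SL2Z mulr1.
by exists p; apply/eqP.
Qed.

(* [m *m g = Delta_I m g *m Delta_bar m g] is the unique decomposition of [m *m g];
   see [Delta_mulE] and [Delta_mul_uniq]. *)
HB.lock Definition Delta_I M (m : Delta M) (g : SL2Z) : SL2Z :=
  (xchoose (Delta_mul_ex m g)).1.
HB.lock Definition Delta_bar M (m : Delta M) (g : SL2Z) : Delta M :=
  (xchoose (Delta_mul_ex m g)).2.

Lemma Delta_mulE M (m : Delta M) (g : SL2Z) :
  m *m g = Delta_I m g *m Delta_bar m g.
Proof. rewrite Delta_I.unlock Delta_bar.unlock; exact/eqP/(xchooseP (Delta_mul_ex m g)). Qed.

Lemma Delta_mul_uniq M (m : Delta M) (g h : SL2Z) (m' : Delta M) :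
  m *m g = h *m m' -> Delta_I m g = h /\ Delta_bar m g = m'.
Proof.
move=> E; have [|p [_ pU]] := @Delta_decomposition M (m *m g) (Delta_gt0 m).
  by rewrite det_mulmx det_Delta det_SL2Z mulr1.
have := pU (h, m') E.
by rewrite (pU (Delta_I m g, Delta_bar m g) (Delta_mulE m g)) => -[-> ->].
Qed.

Lemma Delta_mul1 M (m : Delta M) : Delta_I m 1%g = 1%g /\ Delta_bar m 1%g = m.
Proof. by apply: Delta_mul_uniq; rewrite SL2Z_mx1 mul1mx mulmx1. Qed.

Lemma Delta_mulM M (m : Delta M) (g h : SL2Z) :
  Delta_I m (g * h)%g = (Delta_I m g * Delta_I (Delta_bar m g) h)%g /\
  Delta_bar m (g * h)%g = Delta_bar (Delta_bar m g) h.
Proof.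
apply: Delta_mul_uniq; rewrite !SL2Z_mxM mulmxA Delta_mulE -mulmxA Delta_mulE.
by rewrite mulmxA.
Qed.


(* The tensor product of finite-dimensional spaces, realized as Hom(V^*, W) with
   v (x) w : lam |-> lam(v) w. Its universal property is given by [tlift_tprod]
   (bilinear maps extend) and [tens_ext] (the extension is unique). *)
Definition tens (F : fieldType) (V W : vectType F) := 'Hom('Hom(V, F^o), W).
HB.instance Definition _ F V W := Vector.on (@tens F V W).

HB.lock Definition tprod (F : fieldType) (V W : vectType F) (v : V) (w : W) :
    tens V W :=
  linfun (fun lam : 'Hom(V, F^o) => (lam v : F) *: w).

Definition bilin (F : fieldType) (U V W : vectType F) (b : V -> W -> U) : Prop :=
  (forall w, linear (b^~ w)) /\ (forall v, linear (b v)).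

(* The linear map on [tens V W] induced by [b], meaningful for bilinear [b] only;
   the value does not depend on the basis, by [tlift_tprod] and [tens_ext]. *)
HB.lock Definition tlift (F : fieldType) (U V W : vectType F) (b : V -> W -> U) :
    'Hom(tens V W, U) :=
  linfun (fun t : tens V W =>
    \sum_(i < \dim {:V}) b (vbasis {:V})`_i
      ((t : 'Hom(_, _)) (linfun (coord (vbasis {:V}) i : V -> F^o)))).

HB.lock Definition tens_map (F : fieldType) (U V U' V' : vectType F)
    (A : 'Hom(U, U')) (B : 'Hom(V, V')) : 'Hom(tens U V, tens U' V') :=
  tlift (fun u v => tprod (A u) (B v)).

(* The free vector space on a finite set, with basis [evect F i]. *)
Definition free_vect (F : fieldType) (I : finType) := {ffun I -> F^o}.
HB.instance Definition _ F I := Vector.on (free_vect F I).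

Definition evect (F : fieldType) (I : finType) (i : I) : free_vect F I :=
  [ffun j => (j == i)%:R].

Section Tensor.
Variable F : fieldType.
Implicit Types U V W : vectType F.

Lemma linfunE U V (f : U -> V) : linear f -> linfun f =1 f.
Proof.
move=> lf; pose L := GRing.isLinear.Build F U V *:%R f lf.
pose f' : {linear U -> V} := HB.pack f L.
exact: (lfunE f').
Qed.

Lemma tprodE V W (v : V) (w : W) (lam : 'Hom(V, F^o)) :
  (tprod v w : 'Hom(_, _)) lam = (lam v : F) *: w.
Proof.
rewrite tprod.unlock linfunE // => a x y; rewrite add_lfunE scale_lfunE.
by rewrite scalerDl scalerA.
Qed.

Lemma tprod0l V W (w : W) : tprod (0 : V) w = 0.
Proof. by apply/lfunP => lam; rewrite tprodE linear0 scale0r zero_lfunE. Qed.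

Lemma tprod0r V W (v : V) : tprod v (0 : W) = 0.
Proof. by apply/lfunP => lam; rewrite tprodE scaler0 zero_lfunE. Qed.

Lemma bilin_tprod V W : bilin (@tprod F V W).
Proof.
split=> [w|v] a x y; apply/lfunP => lam; rewrite add_lfunE scale_lfunE !tprodE.
  by rewrite linearP /= scalerDl scalerA.
by rewrite scalerDr !scalerA mulrC.
Qed.

Lemma tlift_tprod U V W (b : V -> W -> U) : bilin b ->
  forall v w, tlift b (tprod v w) = b v w.
Proof.
case=> bl br v w; rewrite tlift.unlock linfunE => [|a x y]; last first.
  rewrite scaler_sumr -big_split /=; apply: eq_bigr => i _.
  by rewrite add_lfunE scale_lfunE br.
pose L := GRing.isLinear.Build F V U *:%R _ (bl w).
pose f : {linear V -> U} := HB.pack (b^~ w) L.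
pose L' x := GRing.isLinear.Build F W U *:%R _ (br x).
pose f' x : {linear W -> U} := HB.pack (b x) (L' x).
rewrite -[RHS]/(f v) [in RHS](coord_vbasis (memvf v)) linear_sum.
apply: eq_bigr => i _; rewrite linearZ /= tprodE linfunE; last first.
  by move=> a x y; rewrite linearP.
by rewrite -[LHS]/(f' _ _) linearZ.
Qed.

Lemma tens_decomp V W (t : tens V W) :
  exists w : 'I_(\dim {:V}) -> W, t = \sum_(i < \dim {:V}) tprod (vbasis {:V})`_i (w i).
Proof.
exists (fun i => (t : 'Hom(_, _)) (linfun (coord (vbasis {:V}) i : V -> F^o))).
apply/lfunP => lam; rewrite sum_lfunE.
have -> : lam = \sum_(i < \dim {:V}) (lam (vbasis {:V})`_i : F) *:
    linfun (coord (vbasis {:V}) i : V -> F^o).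
  apply/lfunP => v; rewrite sum_lfunE [in LHS](coord_vbasis (memvf v)) linear_sum.
  apply: eq_bigr => i _; rewrite linearZ scale_lfunE linfunE ?mulrC //.
    by rewrite /= /GRing.scale /= mulrC.
  by move=> a x y; rewrite linearP.
rewrite linear_sum; apply: eq_bigr => i _; rewrite linearZ tprodE; congr (_ *: _).
rewrite sum_lfunE (bigD1 i) //= big1 => [|j ji]; rewrite scale_lfunE linfunE.
- by rewrite coord_free ?(basis_free (vbasisP _)) // eqxx /GRing.scale /= mulr1 addr0.
- by move=> a x y; rewrite linearP.
- by rewrite coord_free ?(basis_free (vbasisP _)) // eq_sym (negPf ji) /GRing.scale /= mulr0.
- by move=> a x y; rewrite linearP.
Qed.

Lemma tens_ext U V W (f g : 'Hom(tens V W, U)) :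
  (forall v w, f (tprod v w) = g (tprod v w)) -> f = g.
Proof.
move=> fg; apply/lfunP => t; have [w ->] := tens_decomp t.
by rewrite !linear_sum; apply: eq_bigr => i _; apply: fg.
Qed.

Lemma tens_mapE U V U' V' (A : 'Hom(U, U')) (B : 'Hom(V, V')) u v :
  tens_map A B (tprod u v) = tprod (A u) (B v).
Proof.
have [pl pr] := bilin_tprod U' V'.
by rewrite tens_map.unlock tlift_tprod //; split=> [w|w] a x y; rewrite linearP ?pl ?pr.
Qed.

Variable I : finType.
Local Notation free_vect := (free_vect F I).
Local Notation evect := (@evect F I).

Lemma free_decomp (phi : free_vect) : phi = \sum_i (phi i : F) *: evect i.
Proof.
apply/ffunP => j; rewrite sum_ffunE (bigD1 j) //= big1 => [|i ij].
  by rewrite !ffunE eqxx addr0 /GRing.scale /= mulr1.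
by rewrite !ffunE eq_sym (negPf ij) /GRing.scale /= mulr0.
Qed.

Lemma tens_free_ext U V (f g : 'Hom(tens V free_vect, U)) :
  (forall v i, f (tprod v (evect i)) = g (tprod v (evect i))) -> f = g.
Proof.
have [_ pr] := bilin_tprod V free_vect.
move=> fg; apply/tens_ext => v phi.
pose L := GRing.isLinear.Build F _ _ *:%R _ (pr v).
pose p : {linear free_vect -> tens V free_vect} := HB.pack (tprod v) L.
have -> : tprod v phi = \sum_i (phi i : F) *: tprod v (evect i).
  rewrite -[LHS]/(p phi) {1}(free_decomp phi) linear_sum.
  by apply: eq_bigr => i _; rewrite linearZ.
rewrite !linear_sum; apply: eq_bigr => i _; rewrite !linearZ.
by congr (_ *: _); apply: fg.
Qed.
End Tensor.

(* v (x) phi |-> phi(i) v, the coordinate of a tensor along [evect F i]. *)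
HB.lock Definition tcoef (F : fieldType) (V : vectType F) (I : finType) (i : I) :
    'Hom(tens V (free_vect F I), V) :=
  tlift (fun (v : V) (phi : free_vect F I) => (phi i : F) *: v).

Lemma tcoefE (F : fieldType) (V : vectType F) (I : finType) (i : I)
    (v : V) (phi : free_vect F I) :
  tcoef V i (tprod v phi) = (phi i : F) *: v.
Proof.
rewrite tcoef.unlock tlift_tprod //; split=> [w|w] a x y.
  by rewrite scalerDr !scalerA mulrC.
by rewrite !ffunE scalerDl scalerA.
Qed.

Record rep (F : fieldType) (V : vectType F) := Rep {
  rep_map :> SL2Z -> 'End(V);
  rep1 : rep_map 1%g = \1%VF;
  repM : forall g h, rep_map (g * h)%g = (rep_map g \o rep_map h)%VF }.

(* The action on V (x) F[Delta_M]; [hecke_mapE] gives it on v (x) e_m. *)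
HB.lock Definition hecke_map (M : nat) (F : fieldType) (V : vectType F)
    (rho : rep V) (g : SL2Z) : 'End(tens V (free_vect F (Delta M))) :=
  tlift (fun v (phi : free_vect F (Delta M)) => \sum_(m : Delta M) (phi m : F) *:
    tprod ((rho (Delta_I m g^-1%g))^-1%VF v) (evect F (Delta_bar m g^-1%g))).

(* The map (v (x) e_m) (x) (w (x) e_m') |-> (v (x) w) (x) e_m if m = m' and 0
   otherwise; these values characterize it, by [hecke_piE] and
   [hecke_pi_unique]. *)
HB.lock Definition hecke_pi (M : nat) (F : fieldType) (V W : vectType F) :
    'Hom(tens (tens V (free_vect F (Delta M))) (tens W (free_vect F (Delta M))),
         tens (tens V W) (free_vect F (Delta M))) :=
  linfun (fun t => \sum_(m : Delta M)
    tprod (tens_map (tcoef V m) (tcoef W m) t) (evect F m)).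

Section Rep.
Variable F : fieldType.
Implicit Types V W : vectType F.

Lemma repK V (rho : rep V) g : cancel (rho g) (rho g^-1%g).
Proof. by move=> v; rewrite -comp_lfunE -repM mulVg rep1 id_lfunE. Qed.

Lemma rep_inv V (rho : rep V) g : (rho g)^-1%VF = rho g^-1%g.
Proof.
have k0 : lker (rho g) == 0%VS by apply/lker0P/(can_inj (repK rho g)).
apply/lfunP => v.
by rewrite -{1}[v](repK rho g^-1%g) invgK lker0_lfunK.
Qed.

Fact rep_tens1 V W (rho : rep V) (sigma : rep W) :
  tens_map (rho 1%g) (sigma 1%g) = \1%VF.
Proof. by apply/tens_ext => v w; rewrite tens_mapE !rep1 !id_lfunE. Qed.

Fact rep_tensM V W (rho : rep V) (sigma : rep W) g h :
  tens_map (rho (g * h)%g) (sigma (g * h)%g) =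
  (tens_map (rho g) (sigma g) \o tens_map (rho h) (sigma h))%VF.
Proof.
by apply/tens_ext => v w; rewrite comp_lfunE !tens_mapE !repM !comp_lfunE.
Qed.

Definition rep_tens V W (rho : rep V) (sigma : rep W) : rep (tens V W) :=
  Rep (rep_tens1 rho sigma) (rep_tensM rho sigma).

Lemma hecke_mapE M V (rho : rep V) g v (m : Delta M) :
  hecke_map M rho g (tprod v (evect F m)) =
  tprod ((rho (Delta_I m g^-1%g))^-1%VF v) (evect F (Delta_bar m g^-1%g)).
Proof.
have [pl _] := bilin_tprod V (free_vect F (Delta M)).
rewrite hecke_map.unlock tlift_tprod; last first.
  split=> [phi|w] a x y; rewrite scaler_sumr -big_split /=;
    apply: eq_bigr => i _; rewrite scalerA.
    by rewrite linearP pl scalerDr !scalerA mulrC.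
  by rewrite !ffunE scalerDl.
rewrite (bigD1 m) //= big1 => [|i im].
  by rewrite !ffunE eqxx scale1r addr0.
by rewrite !ffunE (negPf im) scale0r.
Qed.

Fact hecke1 M V (rho : rep V) : hecke_map M rho 1%g = \1%VF.
Proof.
apply/tens_free_ext => v m; rewrite hecke_mapE invg1.
by have [-> ->] := Delta_mul1 m; rewrite rep_inv invg1 rep1 !id_lfunE.
Qed.

Fact heckeM M V (rho : rep V) g h : hecke_map M rho (g * h)%g =
  (hecke_map M rho g \o hecke_map M rho h)%VF.
Proof.
apply/tens_free_ext => v m.
rewrite [RHS]comp_lfunE (hecke_mapE _ (g * h)%g) (hecke_mapE _ h) (hecke_mapE _ g).
rewrite invgM.
have [-> ->] := Delta_mulM m h^-1%g g^-1%g.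
by rewrite !rep_inv invgM repM comp_lfunE.
Qed.

Definition hecke (M : nat) V (rho : rep V) : rep (tens V (free_vect F (Delta M))) :=
  Rep (hecke1 M rho) (heckeM M rho).

Lemma hecke_piE M V W v (m : Delta M) w (m' : Delta M) :
  hecke_pi M V W (tprod (tprod v (evect F m)) (tprod w (evect F m'))) =
  if m == m' then tprod (tprod v w) (evect F m) else 0.
Proof.
have [pl _] := bilin_tprod (tens V W) (free_vect F (Delta M)).
rewrite hecke_pi.unlock linfunE => [|a x y]; last first.
  rewrite scaler_sumr -big_split /=; apply: eq_bigr => i _.
  by rewrite linearP pl.
have e i : tens_map (tcoef V i) (tcoef W i)
    (tprod (tprod v (evect F m)) (tprod w (evect F m'))) =
    ((i == m) && (i == m'))%:R *: tprod v w.
  rewrite tens_mapE !tcoefE !ffunE.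
  by case: eqP => _; case: eqP => _ /=; rewrite ?scale1r ?scale0r ?tprod0l ?tprod0r.
rewrite (bigD1 m) //= big1 => [|i /negPf im].
  by rewrite e eqxx addr0; case: eqP => _; rewrite ?scale1r ?scale0r ?tprod0l.
by rewrite e im scale0r tprod0l.
Qed.

Lemma hecke_pi_unique M V W (p : 'Hom(_, _)) :
  (forall v (m : Delta M) w (m' : Delta M),
     p (tprod (tprod v (evect F m)) (tprod w (evect F m'))) =
     if m == m' then tprod (tprod v w) (evect F m) else 0) ->
  p = hecke_pi M V W.
Proof.
move=> pE; apply/tens_ext => x y.
have [pl pr] := bilin_tprod (tens V (free_vect F (Delta M)))
                            (tens W (free_vect F (Delta M))).
pose Q := 'Hom(tens (tens V (free_vect F (Delta M))) (tens W (free_vect F (Delta M))),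
               tens (tens V W) (free_vect F (Delta M))).
pose fx (q : Q) y :=
  linfun (fun x => q (tprod x y)).
pose fy (q : Q) x :=
  linfun (fun y => q (tprod x y)).
have fxE q x' y' : fx q y' x' = q (tprod x' y').
  by rewrite linfunE // => a u v; rewrite pl linearP.
have fyE q x' y' : fy q x' y' = q (tprod x' y').
  by rewrite linfunE // => a u v; rewrite pr linearP.
rewrite -!fxE; congr (fun_of_lfun _ x); apply/tens_free_ext => v m.
rewrite !fxE -!fyE; congr (fun_of_lfun _ y); apply/tens_free_ext => w m'.
by rewrite !fyE pE hecke_piE.
Qed.
End Rep.

Definition rep_ker (F : fieldType) (V : vectType F) (rho : rep V) : set SL2Z :=
  [set g | rho g = \1%VF]%classic.

(* Finitely many left cosets. *)
Definition finite_index (K : set SL2Z) : Prop :=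
  finite_set (range (fun g : SL2Z => [set (g * h)%g | h in K]%classic)).

Section Modular.
Variable R : realType.
Local Notation C := R[i].

Record HH := HHElt { HH_val :> C; _ : 0 < complex.Im HH_val }.
HB.instance Definition _ := [isSub for HH_val].
HB.instance Definition _ := [Choice of HH by <:].

(* The default value of [insubd] is never used when [0 < \det g]: see [mobiusE]. *)
Definition mobius (g : 'M[int]_2) (tau : HH) : HH :=
  insubd tau (((g 0 0)%:~R * (tau : C) + (g 0 1)%:~R) /
              ((g 1 0)%:~R * (tau : C) + (g 1 1)%:~R)).

Lemma mobiusE (g : 'M[int]_2) (tau : HH) : 0 < \det g ->
  mobius g tau = ((g 0 0)%:~R * (tau : C) + (g 0 1)%:~R) /
                 ((g 1 0)%:~R * (tau : C) + (g 1 1)%:~R) :> C.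
Proof.
rewrite {1}[g]mx2P det_mx2E /mobius => dg; rewrite insubdK // unfold_in.
case: tau => -[x y] /= y0.
have intC (m : int) : m%:~R = (m%:~R)%:C :> C by rewrite rmorph_int.
rewrite !intC.
move: (g 0 0) (g 0 1) (g 1 0) (g 1 1) dg => a b c d dg.
have {}dg : 0 < a%:~R * d%:~R - b%:~R * c%:~R :> R.
  by rewrite -!rmorphM -rmorphB /= ltr0z.
move: (a%:~R : R) (b%:~R : R) (c%:~R : R) (d%:~R : R) dg => {}a {}b {}c {}d dg.
rewrite /= !mul0r !subr0 !addr0.
set n := _ ^+ 2 + _ ^+ 2.
have n0 : 0 < n.
  rewrite lt_neqAle eq_sym addr_ge0 ?sqr_ge0 // andbT paddr_eq0 ?sqr_ge0 //.
  rewrite !sqrf_eq0 mulf_eq0 (gt_eqF y0) orbF; apply/negP => /andP[+ /eqP c0].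
  by rewrite c0 mul0r add0r => /eqP d0; move: dg; rewrite c0 d0 !mulr0 subrr ltxx.
rewrite [ltRHS](_ : _ = (a * d - b * c) * y / n); last by ring.
by rewrite divr_gt0 ?mulr_gt0.
Qed.

(* Extension by 0 to the plane. The half-plane being open, this does not affect
   complex differentiability at its points. *)
Definition HH_ext (phi : HH -> C) (z : C) : C := oapp phi 0 (insub z).

Section Space.
Variables (V : vectType C).
Implicit Types (rho : rep V) (f : HH -> V).

(* For finite-dimensional [V], holomorphy is that of all the coordinates; the
   derivative is taken along the scalar field [C], hence is a complex one. *)
Definition holomorphic f : Prop :=
  forall (lam : 'Hom(V, C^o)) (tau : HH),
    derivable (HH_ext (fun t => lam (f t)) : C^o -> C^o) (tau : C) 1.

Definition bounded_at_cusp f : Prop :=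
  forall lam : 'Hom(V, C^o), exists Y B : R, forall tau : HH,
    Y < complex.Im tau -> `|lam (f tau) : C| <= B%:C.

Definition slash (k : int) rho (f : HH -> V) (g : SL2Z) (tau : HH) : V :=
  ((g 1 0)%:~R * (tau : C) + (g 1 1)%:~R) ^ (- k) *:
    rho g^-1%g (f (mobius g tau)).

Definition is_modular (k : int) rho f : Prop :=
  [/\ holomorphic f, forall g, slash k rho f g = f & bounded_at_cusp f].

Definition Mk (k : int) rho : {pred HH -> V} := [pred f | `[< is_modular k rho f >]].

Lemma holomorphicZD a f g :
  holomorphic f -> holomorphic g -> holomorphic (a *: f + g).
Proof.
move=> hf hg lam tau.
rewrite (_ : HH_ext _ = (a *: (HH_ext (fun t => lam (f t)) : C^o -> C^o) +
    (HH_ext (fun t => lam (g t)) : C^o -> C^o))%R); last first.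
  apply/funext => z; 
  rewrite -[RHS]/((a : C) * HH_ext (fun t => lam (f t)) z +
                  HH_ext (fun t => lam (g t)) z) /HH_ext.
  case: insubP => [t _ _|_] /=; last by rewrite mulr0 addr0.
  by rewrite -[LHS]/(lam (a *: f t + g t)) linearP.
by apply: derivableD; [apply: derivableZ; apply: hf | apply: hg].
Qed.

Lemma slash_is_linear k rho g : linear (slash k rho ^~ g).
Proof.
move=> a f1 f2; apply/funext => tau.
rewrite /slash -[RHS]/(a *: slash k rho f1 g tau + slash k rho f2 g tau) /slash.
rewrite -[X in rho _ X]/(a *: f1 _ + f2 _).
by rewrite linearP /= scalerDr !scalerA mulrC.
Qed.

Lemma bounded_at_cuspZD a f g :
  bounded_at_cusp f -> bounded_at_cusp g -> bounded_at_cusp (a *: f + g).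
Proof.
move=> bf bg lam; have [Y [B fB]] := bf lam; have [Y' [B' gB]] := bg lam.
exists (Num.max Y Y'), (Normc.normc a * B + B') => tau; rewrite gt_max => /andP[h h'].
rewrite [X in lam X](_ : _ = a *: f tau + g tau) // linearP.
rewrite (le_trans (ler_normD _ _)) // rmorphD rmorphM /= lerD ?gB //.
by rewrite normrM ler_wpM2l ?fB.
Qed.

Fact Mk_submod k rho : submod_closed (Mk k rho).
Proof.
split=> [|a f g]; rewrite !inE.
  split.
  - move=> lam tau; rewrite (_ : HH_ext _ = (0 : C^o -> C^o)).
      exact: derivable_cst.
    apply/funext => z; rewrite /HH_ext; case: insubP => [t _ _|_] //=.
    by rewrite -[LHS]/(lam 0) linear0.
  - by move=> g; apply/funext => tau; rewrite /slash linear0 scaler0.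
  - by move=> lam; exists 0, 0 => tau _; rewrite linear0 normr0.
case=> hf sf bf [hg sg bg]; split.
- exact: holomorphicZD.
- by move=> h; rewrite slash_is_linear sf sg.
- exact: bounded_at_cuspZD.
Qed.
HB.instance Definition _ k rho := GRing.isSubmodClosed.Build C (HH -> V) (Mk k rho) (Mk_submod k rho).

Record modform (k : int) rho := ModForm
  { modform_fun :> HH -> V; _ : modform_fun \in Mk k rho }.
HB.instance Definition _ k rho := [isSub for @modform_fun k rho].
HB.instance Definition _ k rho := [Choice of modform k rho by <:].
HB.instance Definition _ k rho := [SubChoice_isSubLmodule of modform k rho by <:].

Lemma modformP k rho (f : modform k rho) : is_modular k rho f.
Proof. by case: f => f /= /asboolP. Qed.

Definition slash_Delta (M : nat) (k : int) f (m : Delta M) (tau : HH) : V :=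
  (((m 0 0)%:~R / (m 1 1)%:~R : R) `^ (k%:~R / 2))%:C *: f (mobius m tau).

Definition hecke_op (M : nat) (k : int) f (tau : HH) :
    tens V (free_vect C (Delta M)) :=
  \sum_(m : Delta M) tprod (slash_Delta k f m tau) (evect C m).
End Space.

Definition tens_fun (V W : vectType C) (f : HH -> V) (g : HH -> W) (tau : HH) :
    tens V W :=
  tprod (f tau) (g tau).
End Modular.

(* Main.v *)
Require Import Defs.
From HB Require Import structures.
From mathcomp Require Import all_boot all_order all_algebra complex.
From mathcomp Require Import all_classical all_reals all_analysis.
Import Order.TTheory GRing.Theory Num.Theory.
Import numFieldNormedType.Exports.
Local Open Scope ring_scope.
Local Open Scope complex_scope.

(* The permutation m |-> bar (m g^-1) of Delta_M is the same for all three Hecke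
   representations, and it is injective; so it preserves both m = m' and
   m <> m', which makes [hecke_pi] equivariant. Composition with an equivariant
   map preserves modularity. The product formula holds term by term on the
   diagonal of Delta_M x Delta_M, as (a/d)^(k/2) (a/d)^(l/2) = (a/d)^((k+l)/2).
   That f (x) g is modular follows by writing a functional on a tensor product
   as a finite sum of products of functionals. *)

Section Tensor.
Context {F : fieldType}.
Implicit Types V W U : vectType F.

(** Expanding [v] in a basis of [V] makes the [a i] coordinate functionals and [b i] the functional
    sending [w] to the value of [lam] at the [i]-th basis vector tensor [w]. This reduces the
    analytic conditions on [tens_fun f g] to products of scalar functions. *)
Lemma tens_functional_decomp V W (lam : 'Hom(tens V W, F^o)) :
  exists n (a : 'I_n -> 'Hom(V, F^o)) (b : 'I_n -> 'Hom(W, F^o)),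
    forall v w, lam (tprod v w) = \sum_i (a i v : F) * (b i w : F).
Proof.
have [pl pr] := bilin_tprod V W.
exists (\dim {:V}), (fun i => linfun (coord (vbasis {:V}) i : V -> F^o)),
  (fun i => linfun (fun w => lam (tprod (vbasis {:V})`_i w))) => v w.
pose L := GRing.isLinear.Build F V _ *:%R _ (pl w).
pose p : {linear V -> tens V W} := HB.pack (fun v => tprod v w) L.
rewrite -[tprod v w]/(p v) [in LHS](coord_vbasis (memvf v)) !linear_sum.
apply: eq_bigr => i _; rewrite !linearZ /=.
by rewrite !linfunE // => c x y; rewrite ?pr linearP.
Qed.

Lemma tprod_suml V W I (r : seq I) (E : I -> V) (w : W) :
  tprod (\sum_(i <- r) E i) w = \sum_(i <- r) tprod (E i) w.
Proof.
have [pl _] := bilin_tprod V W.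
elim/big_rec2: _ => [|i x y _ <-]; first exact: tprod0l.
by rewrite -[E i]scale1r pl !scale1r.
Qed.

Lemma tprod_sumr V W I (r : seq I) (v : V) (E : I -> W) :
  tprod v (\sum_(i <- r) E i) = \sum_(i <- r) tprod v (E i).
Proof.
have [_ pr] := bilin_tprod V W.
elim/big_rec2: _ => [|i x y _ <-]; first exact: tprod0r.
by rewrite -[E i]scale1r pr !scale1r.
Qed.

Lemma tprodZ V W (a b : F) (v : V) (w : W) :
  tprod (a *: v) (b *: w) = (a * b) *: tprod v w.
Proof.
have [pl pr] := bilin_tprod V W.
rewrite -[a *: v]addr0 pl -[b *: w]addr0 pr.
by rewrite tprod0l tprod0r !addr0 scalerA.
Qed.

Lemma tens_tens_free_ext (I : finType) U V W
    (p q : 'Hom(tens (tens V (free_vect F I)) (tens W (free_vect F I)), U)) :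
  (forall v i w j, p (tprod (tprod v (evect F i)) (tprod w (evect F j))) =
                   q (tprod (tprod v (evect F i)) (tprod w (evect F j)))) ->
  p = q.
Proof.
move=> pq; apply/tens_ext => x y.
have [pl pr] := bilin_tprod (tens V (free_vect F I)) (tens W (free_vect F I)).
(* One factor is frozen at a time, so that [tens_free_ext] applies to the partial maps [fx] and
   [fy]. *)
pose Q := 'Hom(tens (tens V (free_vect F I)) (tens W (free_vect F I)), U).
pose fx (r : Q) y := linfun (fun x => r (tprod x y)).
pose fy (r : Q) x := linfun (fun y => r (tprod x y)).
have fxE r x' y' : fx r y' x' = r (tprod x' y').
  by rewrite linfunE // => a u v; rewrite pl linearP.
have fyE r x' y' : fy r x' y' = r (tprod x' y').
  by rewrite linfunE // => a u v; rewrite pr linearP.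
rewrite -!fxE; congr (fun_of_lfun _ x); apply/tens_free_ext => v i.
rewrite !fxE -!fyE; congr (fun_of_lfun _ y); apply/tens_free_ext => w j.
by rewrite !fyE.
Qed.

(** [Delta_bar] is a right action of the group, so acting by [g^-1] undoes acting by [g]. *)
Lemma Delta_bar_inj M g : injective (fun m : Delta M => Delta_bar m g).
Proof.
apply: (can_inj (g := fun m => Delta_bar m g^-1%g)) => m.
by rewrite -(Delta_mulM m g g^-1%g).2 mulgV (Delta_mul1 m).2.
Qed.

Lemma hecke_pi_equivariant M V W (rho : rep V) (sigma : rep W) g :
  (hecke_pi M V W \o rep_tens (hecke M rho) (hecke M sigma) g)%VF =
  (hecke M (rep_tens rho sigma) g \o hecke_pi M V W)%VF.
Proof.
apply/tens_tens_free_ext => v m w m'.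
rewrite [LHS]comp_lfunE [RHS]comp_lfunE /= tens_mapE !hecke_mapE !hecke_piE.
(* Off the diagonal both sides vanish. On it, both tensor factors involve the same element
   [Delta_I m g^-1], which therefore acts through [rep_tens rho sigma]. *)
rewrite (inj_eq (@Delta_bar_inj M _)); case: eqP => [<-|_]; last by rewrite linear0.
by rewrite hecke_mapE !rep_inv /= tens_mapE.
Qed.
End Tensor.

Section Modularity.
Context {R : realType}.
Local Notation C := R[i].
Local Notation HH := (HH R).

Lemma holomorphic_comp (V W : vectType C) (A : 'Hom(V, W)) (f : HH -> V) :
  holomorphic f -> holomorphic (A \o f).
Proof.
move=> hf lam tau.
rewrite (_ : (fun t => _) = fun t => (lam \o A)%VF (f t)); first exact: hf.
by apply/funext => t; rewrite comp_lfunE.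
Qed.

Lemma bounded_at_cusp_comp (V W : vectType C) (A : 'Hom(V, W)) (f : HH -> V) :
  bounded_at_cusp f -> bounded_at_cusp (A \o f).
Proof.
move=> bf lam; have [Y [B fB]] := bf (lam \o A)%VF.
by exists Y, B => tau /fB; rewrite comp_lfunE.
Qed.

(** The analytic conditions are tested on functionals, which pull back along [A]; the automorphy
    factor is a scalar, so [A] passes through the slash action. *)
Lemma is_modular_comp (V W : vectType C) (A : 'Hom(V, W)) k
    (rho : rep V) (sigma : rep W) (f : HH -> V) :
  (forall g, (A \o rho g)%VF = (sigma g \o A)%VF) ->
  is_modular k rho f -> is_modular k sigma (A \o f).
Proof.
move=> Ag [hf sf bf]; split; first exact: holomorphic_comp.
- move=> g; apply/funext => tau; rewrite -[in RHS](sf g) /slash /= linearZ /=.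
  by rewrite -[sigma _ _]comp_lfunE -Ag comp_lfunE.
- exact: bounded_at_cusp_comp.
Qed.

Lemma derivable_HH_ext_sumM n (phi psi : 'I_n -> HH -> C) (z : C) :
  (forall i, derivable (HH_ext (phi i) : C^o -> C^o) z 1) ->
  (forall i, derivable (HH_ext (psi i) : C^o -> C^o) z 1) ->
  derivable (HH_ext (fun t => \sum_i phi i t * psi i t) : C^o -> C^o) z 1.
Proof.
move=> dphi dpsi.
rewrite (_ : HH_ext _ = \sum_i (HH_ext (phi i) * HH_ext (psi i) : C^o -> C^o)).
  by apply: derivable_sum => i; apply: derivableM.
apply/funext => x; rewrite fct_sumE /HH_ext.
rewrite (_ : \sum_i _ = \sum_i oapp (phi i) 0 (insub x) * oapp (psi i) 0 (insub x)) //.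
(* Off the half-plane every extension takes its default value 0, and so does the sum of products. *)
by case: insubP => [t _ _|_] //=; rewrite big1 // => i _; rewrite mulr0.
Qed.

Lemma holomorphic_tens (V W : vectType C) (f : HH -> V) (g : HH -> W) :
  holomorphic f -> holomorphic g -> holomorphic (tens_fun f g).
Proof.
move=> hf hg lam tau; have [n [a [b lamE]]] := @tens_functional_decomp C V W lam.
under [X in HH_ext X]eq_fun do rewrite lamE.
by apply: derivable_HH_ext_sumM => i; [apply: hf | apply: hg].
Qed.

Lemma bounded_at_cusp_tens (V W : vectType C) (f : HH -> V) (g : HH -> W) :
  bounded_at_cusp f -> bounded_at_cusp g -> bounded_at_cusp (tens_fun f g).
Proof.
move=> bf bg lam; have [n [a [b lamE]]] := @tens_functional_decomp C V W lam.
(* Height and bound are paired so that a single [choice] selects both for all [i]. *)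
have fB i : exists YB : R * R, forall tau : HH, YB.1 < complex.Im tau ->
    `|a i (f tau) : C| * `|b i (g tau) : C| <= YB.2%:C.
  have [Y [B fB]] := bf (a i); have [Y' [B' gB]] := bg (b i).
  exists (Num.max Y Y', B * B') => tau /=; rewrite gt_max => /andP[h h'].
  by rewrite rmorphM ler_pM ?fB ?gB.
have [YB YBP] := choice fB.
(* The seed 0 of the maximum is harmless: it can only raise the height. *)
exists (\big[Num.max/0]_i (YB i).1), (\sum_i (YB i).2) => tau Ytau.
rewrite lamE rmorph_sum (le_trans (ler_norm_sum _ _ _)) // ler_sum // => i _.
by rewrite normrM YBP // (le_lt_trans _ Ytau) // (le_bigmax _ (fun i => (YB i).1)).
Qed.

(** If the factor vanished, its imaginary part would force [c = 0], then its real part [d = 0],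
    against determinant 1. Splitting a possibly negative power of it relies on this. *)
Lemma automorphy_neq0 (g : SL2Z) (tau : HH) :
  (g 1 0)%:~R * (tau : C) + (g 1 1)%:~R != 0 :> C.
Proof.
have intC (m : int) : m%:~R = (m%:~R)%:C :> C by rewrite rmorph_int.
have := det_SL2Z g; rewrite {1}[g : 'M[int]_2]mx2P det_mx2E !intC.
case: tau => -[x y] /= y0 dg; apply/eqP => -[].
rewrite !mul0r !addr0 subr0 => + /eqP.
rewrite mulf_eq0 (gt_eqF y0) orbF intr_eq0 => + /eqP c0.
rewrite c0 mul0r add0r => /eqP; rewrite intr_eq0 => /eqP d0.
by move: dg; rewrite c0 d0 !mulr0 subrr.
Qed.

Lemma is_modular_tens (V W : vectType C) (rho : rep V) (sigma : rep W) k l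
    (f : HH -> V) (g : HH -> W) :
  is_modular k rho f -> is_modular l sigma g ->
  is_modular (k + l) (rep_tens rho sigma) (tens_fun f g).
Proof.
move=> [hf sf bf] [hg sg bg]; split.
- exact: holomorphic_tens.
- move=> h; apply/funext => tau.
  rewrite /tens_fun -[in RHS](sf h) -[in RHS](sg h) /slash /= tens_mapE tprodZ.
  by rewrite opprD expfzDr // automorphy_neq0.
- exact: bounded_at_cusp_tens.
Qed.

Lemma slash_Delta_tens (V W : vectType C) M k l (f : HH -> V) (g : HH -> W)
    (m : Delta M) tau :
  slash_Delta (k + l) (tens_fun f g) m tau =
  tprod (slash_Delta k f m tau) (slash_Delta l g m tau).
Proof.
rewrite /slash_Delta tprodZ -rmorphM -powRD -?mulrDl -?rmorphD //.
(* Left is the side condition of [powRD]: the base is nonzero if the exponents sum to 0. It holds as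
   both diagonal entries are positive. *)
case: m => m /= /and5P[_ a0 d0 _ _].
by rewrite mulf_neq0 ?implybT // ?invr_eq0 intr_eq0 gt_eqF.
Qed.

Lemma hecke_pi_hecke_op (V W : vectType C) M k l (f : HH -> V) (g : HH -> W) :
  hecke_pi M V W \o tens_fun (hecke_op M k f) (hecke_op M l g) =
  hecke_op M (k + l) (tens_fun f g).
Proof.
apply/funext => tau; rewrite /= /hecke_op {1}/tens_fun tprod_suml linear_sum.
(* For fixed [m], only the index [m' = m] survives in the inner sum. *)
apply: eq_bigr => m _; rewrite tprod_sumr linear_sum (bigD1 m) //= big1.
  by rewrite hecke_piE eqxx addr0 slash_Delta_tens.
by move=> m' m'm; rewrite hecke_piE eq_sym (negPf m'm).
Qed.

Lemma modform_comp_linear (V W : vectType C) (A : 'Hom(V, W)) k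
    (rho : rep V) (sigma : rep W) :
  (forall g, (A \o rho g)%VF = (sigma g \o A)%VF) ->
  exists Phi : {linear modform k rho -> modform k sigma},
    forall F, Phi F = A \o F :> (HH -> W).
Proof.
move=> Ag.
have AP (F : modform k rho) : A \o F \in Mk k sigma.
  by apply/asboolP; apply: is_modular_comp Ag _; apply: modformP.
pose Phi F := ModForm (AP F).
have lPhi : linear Phi.
  move=> a F G; apply/val_inj/funext => tau.
  by rewrite -[RHS]/(a *: A (F tau) + A (G tau)) -linearP.
pose L := GRing.isLinear.Build C _ _ *:%R Phi lPhi.
pose PhiL : {linear modform k rho -> modform k sigma} := HB.pack Phi L.
by exists PhiL.
Qed.
End Modularity.

Theorem theorem2p8 (R : realType) (M : nat) (M_gt0 : (0 < M)%N)
    (V W : vectType R[i]) (rho : rep V) (sigma : rep W)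
    (rho_fin : finite_index (rep_ker rho))
    (sigma_fin : finite_index (rep_ker sigma)) :
  (forall k : int,
     exists Phi : {linear modform k (rep_tens (hecke M rho) (hecke M sigma)) ->
                          modform k (hecke M (rep_tens rho sigma))},
       forall F, Phi F = hecke_pi M V W \o F :> (HH R -> _)) /\
  (forall (k l : int) (f : modform k rho) (g : modform l sigma),
     is_modular (k + l) (rep_tens rho sigma) (tens_fun f g) /\
     hecke_pi M V W \o tens_fun (hecke_op M k f) (hecke_op M l g) =
       hecke_op M (k + l) (tens_fun f g)).
Proof.
split=> [k|k l f g]; first exact/modform_comp_linear/hecke_pi_equivariant.
split; last exact: hecke_pi_hecke_op.
by apply: is_modular_tens; apply: modformP.
Qed.
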